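(* The variety $\mathrm{Leib}^n$ of Leibniz algebra laws on $\mathbb{C}^n$ is reducible for every $n\geq 2$. In fact: $\mathrm{Leib}^6$ has at least $5$ irreducible components; $\mathrm{Leib}^7$ has at least $8$ irreducible components; $\mathrm{Leib}^8$ has at least $33$ irreducible components; $\mathrm{Leib}^9$ has at least $41$ irreducible components. Moreover, for $n\geq 81$, the number of irreducible components of $\mathrm{Leib}^n$ is bounded from below by $\Gamma(\sqrt{n})$, where $\Gamma$ is the Euler gamma function.
   Context: A Leibniz algebra law on $\mathbb{C}^n$ is a bilinear map $\mu:\mathbb{C}^n\times\mathbb{C}^n\to\mathbb{C}^n$ satisfying $\mu(x,\mu(y,z))=\mu(\mu(x,y),z)-\mu(\mu(x,z),y)$ for all $x,y,z$. $\mathrm{Leib}^n$ denotes the set of all Leibniz algebra laws on $\mathbb{C}^n$; identifying a law with its structure constants $(a_{ij}^k)$, $\mu(e_i,e_j)=\sum_k a_{ij}^k e_k$, in a fixed basis, it is an algebraic subset of $\mathbb{C}^{n^3}$. Reducibility and irreducible components are taken in the Zariski topology. *)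

(* Defs.v *)
From HB Require Import structures.
From mathcomp Require Import all_boot all_order all_algebra.
From mathcomp Require Import all_classical all_reals all_analysis.
From mathcomp Require Import sesquilinear.
From mathcomp.real_closed Require Import complex.
(* without its notations, which are incompatible with those of analysis *)
From mathcomp.multinomials Require Import -(notations) mpoly.

Set Implicit Arguments.
Unset Strict Implicit.
Unset Printing Implicit Defensive.

Import Order.TTheory GRing.Theory Num.Theory.

Local Open Scope classical_set_scope.
Local Open Scope ring_scope.

Definition affine_space (K : fieldType) (I : finType) : Type := {ffun I -> K}.

HB.instance Definition _ (K : fieldType) (I : finType) :=
  Choice.copy (affine_space K I) {ffun I -> K}.

(* The variable of index k is the coordinate [enum_val k : I]. *)
Notation coord_poly K I := (mpoly #|I : finType| K).

Definition peval (K : fieldType) (I : finType) (a : affine_space K I)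
    (p : coord_poly K I) : K :=
  meval (fun k => a (enum_val k)) p.

Definition zero_locus (K : fieldType) (I : finType) (P : set (coord_poly K I)) :
    set (affine_space K I) :=
  [set a | forall p, P p -> peval a p = 0].

Definition zariski_open (K : fieldType) (I : finType) :
    set_system (affine_space K I) :=
  [set U | exists P : set (coord_poly K I), U = ~` zero_locus P].

Lemma zariski_openT (K : fieldType) (I : finType) :
  @zariski_open K I setT.
Proof.
exists setT; suff -> : @zero_locus K I setT = set0 by rewrite setC0.
apply/seteqP; split=> // a /(_ (mpolyC _ 1) Logic.I).
by rewrite /peval mevalC => /eqP; rewrite oner_eq0.
Qed.

Lemma zariski_openI (K : fieldType) (I : finType) :
  setI_closed (@zariski_open K I).
Proof.
move=> _ _ [P ->] [Q ->].
exists [set r | exists p q, [/\ P p, Q q & r = p * q]].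
rewrite -setCU; apply: (congr1 setC); apply/seteqP; split=> a.
  by case=> za r [p [q [Pp Qq ->]]]; rewrite /peval mevalM;
    [rewrite [X in X * _]za ?mul0r|rewrite [X in _ * X]za ?mulr0].
move=> za; have [zP|] := pselect (zero_locus P a); first by left.
move=> /existsNP[p /not_implyP[Pp /eqP pa]]; right=> q Qq.
have /eqP := za _ (ex_intro _ p (ex_intro _ q (And3 Pp Qq erefl))).
by rewrite /peval mevalM mulf_eq0 => /orP[pa0|/eqP//]; case/negP: pa.
Qed.

Lemma zariski_open_bigU (K : fieldType) (I : finType) (J : Type)
    (f : J -> set (affine_space K I)) :
  (forall j, zariski_open (f j)) -> zariski_open (\bigcup_j f j).
Proof.
move=> /choice[P fP]; exists (\bigcup_j P j).
rewrite (eq_bigcupr (fun j _ => fP j)) -setC_bigcap; apply: (congr1 setC).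
apply/seteqP; split=> a za; first by move=> p [j _ Pjp]; exact: (za j).
by move=> j _ p Pjp; apply: za; exists j.
Qed.

HB.instance Definition _ (K : fieldType) (I : finType) :=
  isOpenTopological.Build (affine_space K I) (@zariski_openT K I)
    (@zariski_openI K I) (@zariski_open_bigU K I).

Lemma zariski_closedP (K : fieldType) (I : finType) (Z : set (affine_space K I)) :
  closed Z <-> exists P : set (coord_poly K I), Z = zero_locus P.
Proof.
rewrite -openC; split=> -[P ZP]; exists P; last by rewrite ZP.
by rewrite -[Z]setCK ZP setCK.
Qed.

(* Irreducibility of A for the topology induced by T: A is nonempty and is not
   the union of two proper relatively closed subsets. *)
Definition irreducible (T : topologicalType) (A : set T) : Prop :=
  A !=set0 /\
  forall F G : set T, closed F -> closed G ->
    A `<=` F `|` G -> A `<=` F \/ A `<=` G.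

Definition irreducible_components (T : topologicalType) (A : set T) :
    set (set T) :=
  [set Z | [/\ Z `<=` A, irreducible Z &
    forall W : set T, W `<=` A -> irreducible W -> Z `<=` W -> W = Z]].

Definition num_irreducible_components (R : realType) (T : topologicalType)
    (A : set T) : \bar R :=
  counting (irreducible_components A).
Arguments num_irreducible_components R {T} A.

Definition leibniz_law (K : fieldType) (n : nat)
    (mu : {bilinear 'rV[K]_n -> 'rV[K]_n -> 'rV[K]_n}) : Prop :=
  forall x y z : 'rV[K]_n,
    mu x (mu y z) = mu (mu x y) z - mu (mu x z) y.

(* The coordinate of index (i, j, k) is the coefficient of e_k in mu(e_i, e_j),
   for the canonical basis e of K^n. *)
Definition structure_constants (K : fieldType) (n : nat)
    (mu : {bilinear 'rV[K]_n -> 'rV[K]_n -> 'rV[K]_n}) :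
    affine_space K ('I_n * 'I_n * 'I_n)%type :=
  [ffun t => mu (delta_mx 0 t.1.1) (delta_mx 0 t.1.2) 0 t.2].

Definition Leib (K : fieldType) (n : nat) :
    set (affine_space K ('I_n * 'I_n * 'I_n)%type) :=
  [set structure_constants mu | mu in @leibniz_law K n].
Arguments Leib : clear implicits.

Definition Gamma (R : realType) (x : R) : \bar R :=
  (\int[lebesgue_measure]_(t in `]0%R, +oo[) (t `^ (x - 1) * expR (- t))%:E)%E.

(* Main.v *)
Require Import Defs.
From HB Require Import structures.
From mathcomp Require Import all_boot all_order all_algebra.
From mathcomp Require Import all_classical all_reals all_analysis.
From mathcomp Require Import finmap sesquilinear measurable_realfun.
From mathcomp.real_closed Require Import complex.
From mathcomp.multinomials Require Import -(notations) mpoly.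
From mathcomp Require Import zify ring lra.

(** A topological space has at least as many irreducible components as it has
pairwise disjoint nonempty open subsets: each such subset meets a component,
and an irreducible set cannot meet two of them
([num_irreducible_components_ge]). The proof therefore constructs many pairwise
disjoint nonempty open subsets of Leib^n, in a single family indexed by codes
[(m, w)], where m is a number of vertices and w is a binary word of length
p < m (or p = 0).

Write n = N + 1. The law attached to [(m, w)] ([model]) has a basis e_0, ...,
e_N in which right multiplication by e_0 is diagonal, with integer weights. The
vectors e_1, ..., e_m are vertices; e_(m+a) with 1 <= a <= p is the edge joining
the vertices a and a + 1, that is, the product of e_a and e_(a+1) in both orders
up to nonzero scalars; all other products of two vectors among e_1, ..., e_N are
zero. Besides its weight, e_c with c > 0 carries a type. It is of Lie type if
e_0 e_c = - e_c e_0, and lies in the ideal spanned by the squares if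
e_0 e_c = 0 <> e_c e_0. All vertices are of Lie type, the letters of w prescribe
the types of the edges, and the remaining vectors are in the ideal. The only sums of two nonzero weights that are again
weights are those forced by the edges ([weight_sumP]).

The open set attached to [(m, w)] ([chart]) consists of the laws for which the
eigenvalues t_0, ..., t_N of right multiplication by e_0 can be so ordered that
they are distinct, t_i + t_j <> t_k whenever the same holds for the weights, and
the products of eigenvectors that are nonzero for the model remain nonzero, as
well as the elements e_0 e_c + e_c e_0 of the ideal when e_c is not of Lie type.
As right multiplication by e_0 is a derivation, a nonzero product of
eigenvectors is an eigenvector for the sum of the eigenvalues; hence the
additive relations between the t_i are exactly those between the weights. In
the same way the types can be read off from the law ([chart_spectrum]). A law in
the open sets of two codes thus provides a bijection between two weighted,
typed index sets, which must map a path of edges to a path of edges, forward or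
backward. So both codes have the same m and the same word up to reversal
([code_recovery], [chart_disjoint]).

That such a set is open does not follow from its definition, because the
eigenvalues are not polynomial functions of the law. The quantifiers over
eigenvalues are eliminated one at a time: for a polynomial P, there is an
eigenvalue r of A with P(r) <> 0 if and only if P(A) is not nilpotent, that is,
if some entry of P(A)^(N+1) is nonzero ([horner_mx_nilpotentPn],
[open_exists_eigenvalues]).

It remains to count codes up to reversal of the word. Words of length at most 3
give 15, 21, 33 and 45 codes for n = 6, 7, 8 and 9. For large n, the words that
start with false and end with true are never reversals of one another, and with
m = p + 1 there are 2^(p-2) of them, where p is about n/2. On the other side,
with a = sqrt n - 1, the bound t^a e^(-t) <= 2^(a^2/2) e^(-t/2) shows that
Gamma(sqrt n) <= 2 * 2^(a^2/2) ([Gamma_le]), and a^2/2 is n/2 - sqrt n + 1/2,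
which leaves enough room as soon as sqrt n >= 9. *)

Set Implicit Arguments.
Unset Strict Implicit.
Unset Printing Implicit Defensive.

Import Order.TTheory GRing.Theory Num.Theory.

Local Open Scope classical_set_scope.
Local Open Scope ring_scope.

(** * Irreducible components and disjoint open sets *)

(** Zorn's lemma is applied to the sets B for which B with p added is
irreducible, rather than to the irreducible sets that contain p, so that the
union of the empty chain is covered. *)
Lemma exists_irreducible_component (T : topologicalType) (A : set T) (p : T) :
  A p -> exists2 Z, irreducible_components A Z & Z p.
Proof.
move=> Ap.
pose P := [set B | B `<=` A /\ irreducible (p |` B)].
have [C CP totC|B [[BA Birr] Bmax]] := @Zorn_bigcup T P.
  split; first by move=> z [B /CP[BA _] /BA].
  split; first by exists p; left.
  move=> F G Fc Gc FG.
  have [[B0 CB0]|/set0P/negP/negPn/eqP C0] := pselect (C !=set0); last first.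
    rewrite C0 bigcup_set0 setU0 in FG *.
    by have [] := FG p erefl; [left|right] => z ->.
  have inC z : (p |` \bigcup_(X in C) X) z -> exists2 B, C B & (p |` B) z.
    by case=> [->|[B CB Bz]]; [exists B0 => //; left|exists B => //; right].
  have [|/existsNP[z1 /not_implyP[/inC[B1 CB1 Bz1] Fz1]]] :=
    pselect (p |` \bigcup_(X in C) X `<=` F); first by left.
  right=> z2 /inC[B2 CB2 Bz2].
  (* F misses z1 and G might miss z2; both lie in one member of the chain. *)
  have [B [CB B1z B2z]] : exists B, [/\ C B, (p |` B) z1 & (p |` B) z2].
    have [B12|B21] := totC _ _ CB1 CB2; [exists B2|exists B1]; split=> //.
      by case: Bz1 => [|/B12]; [left|right].
    by case: Bz2 => [|/B21]; [left|right].
  have [_ [_ /(_ F G Fc Gc)[z Bz|/(_ _ B1z)//|]]] := CP _ CB; last exact.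
  by apply: FG; case: Bz => [|Bz]; [left|right; exists B].
have pBA : p |` B `<=` A by move=> z [->|/BA].
exists (p |` B); last by left.
split=> // W WA Wirr BW; apply/seteqP; split=> // z Wz; right.
apply: contrapT => Bz; have pW : p |` W = W.
  by apply/seteqP; split=> [y [->|//]|y]; [apply: BW; left|right].
apply: (Bmax W); last by split=> //; rewrite pW.
split; first by move=> y By; apply: BW; right.
by move=> /(_ _ Wz).
Qed.

Section SeparatedPoints.
Variables (T : topologicalType) (A : set T) (J : Type).
Variables (p : J -> T) (U : J -> set T).
Hypothesis pA : forall j, A (p j).
Hypothesis pU : forall j, U j (p j).
Hypothesis Uo : forall j, open (U j).
Hypothesis Udisj : forall j k a, A a -> U j a -> U k a -> j = k.

Lemma irreducible_separated (Z : set T) j k :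
  Z `<=` A -> irreducible Z -> Z (p j) -> Z (p k) -> j = k.
Proof.
move=> ZA [_ Zirr] Zj Zk; apply: contrapT => jk.
have [|||/(_ _ Zj)|/(_ _ Zk)] := Zirr (~` U j) (~` U k); last 2 first.
- exact.
- exact.
- exact: open_closedC.
- exact: open_closedC.
move=> z Zz; apply/not_andP => -[Uj Uk].
by apply: jk; apply: Udisj Uj Uk; apply: ZA.
Qed.

End SeparatedPoints.

(** Choosing a component through each point [p j] is injective, because an
irreducible set which meets both [U j] and [U k] also meets their
intersection. *)
Lemma num_irreducible_components_ge (R : realType) (T : topologicalType)
    (A : set T) (J : finType) (p : J -> T) (U : J -> set T) :
  (forall j, A (p j)) -> (forall j, U j (p j)) -> (forall j, open (U j)) ->
  (forall j k a, A a -> U j a -> U k a -> j = k) ->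
  (#|J|%:R%:E <= num_irreducible_components R A)%E.
Proof.
move=> pA pU Uo Udisj.
have /choice[C CP] j : exists Z, irreducible_components A Z /\ Z (p j).
  by have [Z] := exists_irreducible_component (pA j); exists Z.
have Cinj : injective C.
  move=> j k Cjk; have [[ZA Zirr _] Zj] := CP j; have [_ Zk] := CP k.
  by apply: (irreducible_separated pU Uo Udisj ZA Zirr Zj); rewrite Cjk.
rewrite /num_irreducible_components /counting; case: asboolP => [fin|]; last first.
  by rewrite leey.
rewrite lee_fin ler_nat.
have -> : #|J| = #|` [fset C j | j in J]%fset|.
  by rewrite finmap.card_imfset //= cardE.
apply: finmap.fsubset_leq_card; apply/finmap.fsubsetP => _ /finmap.imfsetP[j _ ->].
by rewrite in_fset_set//; apply: mem_set; have [] := CP j.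
Qed.

(** * Openness of conditions on eigenvalues *)

Lemma mul_horner_mx_eigenvector (K : comNzRingType) (N : nat)
    (A : 'M[K]_N.+1) (F : {poly K}) (r : K) (v : 'rV[K]_N.+1) :
  v *m A = r *: v -> v *m horner_mx A F = F.[r] *: v.
Proof.
move=> vA; elim/poly_ind: F => [|F c IH]; first by rewrite rmorph0 mulmx0 horner0 scale0r.
rewrite rmorphD rmorphM /= horner_mx_X horner_mx_C mulmxDr mulmxA IH hornerMXaddC.
by rewrite -scalemxAl vA scalerA mul_mx_scalar scalerDl.
Qed.

(** If F vanishes at all the eigenvalues of A, then each of the N + 1 linear
factors of the characteristic polynomial divides F, so the characteristic
polynomial divides F^(N+1). This turns a condition on an unspecified eigenvalue
into polynomial conditions on the entries of A. *)
Lemma horner_mx_nilpotentPn (K : closedFieldType) (N : nat) (A : 'M[K]_N.+1)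
    (F : {poly K}) :
  (exists2 r, root (char_poly A) r & F.[r] != 0) <->
  (horner_mx A F ^+ N.+1 != 0).
Proof.
split=> [[r]|hF].
  rewrite -eigenvalue_root_char => /eigenvalueP[v vA v0] Fr.
  apply: contraNneq v0 => F0.
  have := mul_horner_mx_eigenvector (F ^+ N.+1) vA.
  rewrite rmorphXn /= F0 mulmx0 horner_exp => /esym/eqP; rewrite scaler_eq0.
  by rewrite expf_eq0 /= (negbTE Fr).
apply: contrapT => noroot; move/negP: hF; apply.
have [rs chiE] := closed_field_poly_normal (char_poly A).
rewrite (monicP (char_poly_monic A)) scale1r in chiE.
have rs_size : size rs = N.+1.
  by have := size_char_poly A; rewrite chiE size_prod_XsubC => -[].
have : \prod_(z <- rs) ('X - z%:P) %| F ^+ size rs.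
  have : {in rs, forall z, root F z}.
    move=> z zrs; apply: contrapT => /negP Fz; apply: noroot; exists z => //.
    by rewrite chiE root_prod_XsubC.
  elim: (rs) => [|z s IH] sF; first by rewrite big_nil dvd1p.
  rewrite big_cons exprS dvdp_mul//; first by rewrite dvdp_XsubCl sF ?mem_head.
  by apply: IH => y ys; apply: sF; rewrite in_cons ys orbT.
rewrite rs_size -chiE => /dvdpP[q Fq].
by rewrite -rmorphXn /= Fq rmorphM /= Cayley_Hamilton mulr0.
Qed.

Section Regular.
Variables (K : closedFieldType) (I : finType).
Implicit Types (f g : seq K -> affine_space K I -> K).

(** Polynomial functions of a point a of an affine space and of countably many
parameters t_0, t_1, ..., given as a list with default value 0. Functions are
used instead of polynomials because the elimination of the parameters consumes
them one by one: a list makes t_0 a distinguished variable, and consing a value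
shifts the others. *)
Inductive regular : (seq K -> affine_space K I -> K) -> Prop :=
| regular_cst c : regular (fun _ _ => c)
| regular_var i : regular (fun t _ => t`_i)
| regular_coord i : regular (fun _ a => a i)
| regularD f g : regular f -> regular g -> regular (fun t a => f t a + g t a)
| regularM f g : regular f -> regular g -> regular (fun t a => f t a * g t a).

Lemma regular_ext f g : regular g -> (forall t a, f t a = g t a) -> regular f.
Proof.
by move=> ? fg; suff -> : f = g by []; apply/funext => t; apply/funext => a; exact: fg.
Qed.

Lemma regularN f : regular f -> regular (fun t a => - f t a).
Proof.
move=> fr; apply: (regular_ext (g := fun t a => -1 * f t a)) => [|t a].
  by apply: regularM => //; apply: regular_cst.
by rewrite mulN1r.
Qed.

Lemma regular_sum (J : Type) (r : seq J) (P : pred J)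
    (F : J -> seq K -> affine_space K I -> K) :
  (forall j, P j -> regular (F j)) ->
  regular (fun t a => \sum_(j <- r | P j) F j t a).
Proof.
move=> Fr; elim: r => [|j r IH].
  apply: (regular_ext (g := fun _ _ => 0)); first exact: regular_cst.
  by move=> t a; rewrite big_nil.
have [Pj|Pj] := boolP (P j).
  apply: (regular_ext (g := fun t a =>
    F j t a + \sum_(i <- r | P i) F i t a)); first by apply: regularD => //; apply: Fr.
  by move=> t a; rewrite big_cons Pj.
apply: (regular_ext (g := fun t a => \sum_(i <- r | P i) F i t a)) => //.
by move=> t a; rewrite big_cons (negbTE Pj).
Qed.

Lemma regular_prod (J : Type) (r : seq J)
    (F : J -> seq K -> affine_space K I -> K) :
  (forall j, regular (F j)) -> regular (fun t a => \prod_(j <- r) F j t a).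
Proof.
move=> Fr; elim: r => [|j r IH].
  apply: (regular_ext (g := fun _ _ => 1)); first exact: regular_cst.
  by move=> t a; rewrite big_nil.
apply: (regular_ext (g := fun t a => F j t a * \prod_(i <- r) F i t a)).
  exact: regularM.
by move=> t a; rewrite big_cons.
Qed.

Lemma open_regular0 f : regular f -> open [set a | f [::] a != 0].
Proof.
move=> fr; suff [p fp] : exists p : coord_poly K I, forall a, f [::] a = peval a p.
  exists [set p]; apply/seteqP; split=> a /=.
    by move=> fa /(_ p erefl) pa; move: fa; rewrite fp pa eqxx.
  by move=> fa; apply/eqP => fa0; apply: fa => _ ->; rewrite -fp.
elim: fr => [c|i|i|{}f g _ [p fp] _ [q gq]|{}f g _ [p fp] _ [q gq]].
- by exists (mpolyC _ c) => a; rewrite /peval mevalC.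
- by exists 0 => a; rewrite nth_nil /peval meval0.
- exists (mpolyX _ (mnm1 (enum_rank i))) => a.
  by rewrite /peval mevalXU enum_rankK.
- by exists (p + q) => a; rewrite /peval mevalD fp gq.
- by exists (p * q) => a; rewrite /peval mevalM fp gq.
Qed.

(** The degree in the first parameter is bounded uniformly and the coefficients
are polynomial functions again, so that substituting a matrix for this parameter
gives polynomial entries. *)
Lemma regular_head_poly f : regular f ->
  exists (P : seq K -> affine_space K I -> {poly K}) (D : nat),
  [/\ forall d, regular (fun t a => (P t a)`_d),
    forall t a, (size (P t a) <= D)%N &
    forall r t a, f (r :: t) a = (P t a).[r]].
Proof.
elim=> [c|[|i]|i|{}f g _ [P [D [Pr PD fP]]] _ [Q [E [Qr QE gQ]]]|
        {}f g _ [P [D [Pr PD fP]]] _ [Q [E [Qr QE gQ]]]].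
- exists (fun _ _ => c%:P), 1%N; split=> [d|t a|r t a]; rewrite ?hornerC //.
    exact: regular_cst.
  exact: size_polyC_leq1.
- exists (fun _ _ => 'X), 2%N; split=> [d|t a|r t a]; rewrite ?hornerX //.
    exact: regular_cst.
  by rewrite size_polyX.
- exists (fun t _ => (t`_i)%:P), 1%N; split=> [d|t a|r t a]; rewrite ?hornerC //.
    apply: (regular_ext (g := fun t _ => (if d == 0%N then t`_i else 0))).
      by case: eqP => _; [apply: regular_var|apply: regular_cst].
    by move=> t a; rewrite coefC.
  exact: size_polyC_leq1.
- exists (fun _ a => (a i)%:P), 1%N; split=> [d|t a|r t a]; rewrite ?hornerC //.
    apply: (regular_ext (g := fun _ a => (if d == 0%N then a i else 0))).
      by case: eqP => _; [apply: regular_coord|apply: regular_cst].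
    by move=> t a; rewrite coefC.
  exact: size_polyC_leq1.
- exists (fun t a => P t a + Q t a), (maxn D E); split=> [d|t a|r t a].
  + apply: (regular_ext (g := fun t a => (P t a)`_d + (Q t a)`_d)).
      exact: regularD.
    by move=> t a; rewrite coefD.
  + apply: leq_trans (size_polyD _ _) _.
    by rewrite geq_max !leq_max PD QE orbT.
  + by rewrite hornerD fP gQ.
- exists (fun t a => P t a * Q t a), (D + E)%N; split=> [d|t a|r t a].
  + apply: (regular_ext (g := fun t a => \sum_(j < d.+1) (P t a)`_j * (Q t a)`_(d - j))).
      by apply: regular_sum => j _; apply: regularM.
    by move=> t a; rewrite coefM.
  + apply: leq_trans (size_polyMleq _ _) _.
    by apply: leq_trans (leq_pred _) _; apply: leq_add.
  + by rewrite hornerM fP gQ.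
Qed.

Definition mx_regular (m n : nat) (M : seq K -> affine_space K I -> 'M[K]_(m, n)) :=
  forall i j, regular (fun t a => M t a i j).

Lemma mx_regular_ext (m n : nat)
    (M1 M2 : seq K -> affine_space K I -> 'M[K]_(m, n)) :
  mx_regular M2 -> (forall t a, M1 t a = M2 t a) -> mx_regular M1.
Proof. by move=> r2 e i j; apply: regular_ext (r2 i j) _ => t a; rewrite e. Qed.

Lemma mx_regularM (m n p : nat)
    (M1 : seq K -> affine_space K I -> 'M[K]_(m, n))
    (M2 : seq K -> affine_space K I -> 'M[K]_(n, p)) :
  mx_regular M1 -> mx_regular M2 -> mx_regular (fun t a => M1 t a *m M2 t a).
Proof.
move=> r1 r2 i j.
apply: (regular_ext (g := fun t a => \sum_k M1 t a i k * M2 t a k j)).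
  by apply: regular_sum => k _; apply: regularM.
by move=> t a; rewrite mxE.
Qed.

Lemma mx_regular_prod (N : nat) (J : Type) (r : seq J) (P : pred J)
    (M : J -> seq K -> affine_space K I -> 'M[K]_N.+1) :
  (forall j, mx_regular (M j)) -> mx_regular (fun t a => \prod_(j <- r | P j) M j t a).
Proof.
move=> Mr; elim: r => [|k r IH].
  move=> i j; apply: (regular_ext (g := fun _ _ => (1 : 'M[K]_N.+1) i j)).
    exact: regular_cst.
  by move=> t a; rewrite big_nil.
have [Pk|Pk] := boolP (P k).
  apply: (mx_regular_ext (M2 := fun t a => M k t a *m \prod_(i <- r | P i) M i t a)).
    exact: mx_regularM.
  by move=> t a; rewrite big_cons Pk.
apply: (mx_regular_ext (M2 := fun t a => \prod_(i <- r | P i) M i t a)) => //.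
by move=> t a; rewrite big_cons (negbTE Pk).
Qed.

(** The closed analogue of this statement is that the projection from the space
of pairs (a, t), with t a list of eigenvalues of A a, is a closed map, as is any
finite map. *)
Lemma open_exists_eigenvalues (N : nat) (A : affine_space K I -> 'M[K]_N.+1) :
  mx_regular (fun _ a => A a) ->
  forall k f, regular f ->
  open [set a | exists t, [/\ size t = k, all (root (char_poly (A a))) t &
                              f t a != 0]].
Proof.
move=> Ar; elim=> [|k IH] f fr.
  rewrite (_ : [set a | _] = [set a | f [::] a != 0]); first exact: open_regular0.
  by apply/seteqP; split=> [a [t [/size0nil -> _]]//|a fa]; exists [::].
have [P [D [Pr PD fP]]] := regular_head_poly fr.
pose M t a := horner_mx (A a) (P t a) ^+ N.+1.
have Mr : mx_regular M.
  apply: (mx_regular_ext (M2 := fun t a =>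
    \prod_(i < N.+1) \sum_(d < D) ((P t a)`_d *: A a ^+ d))).
    apply: mx_regular_prod => _ i j.
    apply: (regular_ext (g := fun t a => \sum_(d < D) (P t a)`_d * (\prod_(e < d) A a) i j)).
      apply: regular_sum => d _; apply: regularM => //.
      exact: mx_regular_prod.
    move=> t a; rewrite summxE.
    by apply: eq_bigr => d _; rewrite mxE prodr_const card_ord.
  move=> t a; rewrite prodr_const card_ord /M.
  congr (_ ^+ _).
  have -> : P t a = \poly_(d < D) (P t a)`_d.
    apply/polyP => d; rewrite coef_poly; case: ltnP => // Dd.
    by rewrite nth_default// (leq_trans (PD _ _)).
  rewrite poly_def rmorph_sum /=; apply: eq_bigr => d _.
  rewrite linearZ /= rmorphXn /= horner_mx_X -poly_def; congr (_ *: _).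
  by rewrite coef_poly ltn_ord.
rewrite (_ : [set a | _] = \bigcup_(ij in setT) [set a | exists t,
    [/\ size t = k, all (root (char_poly (A a))) t & M t a ij.1 ij.2 != 0]]).
  by apply: bigcup_open => -[i j] _; apply: IH.
apply/seteqP; split=> a.
  move=> [[|r t] [//= [tk] /andP[ra ta]]]; rewrite fP => Pra.
  have : M t a != 0 by apply/horner_mx_nilpotentPn; exists r.
  by case/matrix0Pn => i [j Mij]; exists (i, j) => //; exists t.
move=> [[i j] _ [t [tk ta Mij]]].
have : M t a != 0 by apply/matrix0Pn; exists i, j.
case/horner_mx_nilpotentPn => r ra Pra.
by exists (r :: t); rewrite /= tk ra ta fP.
Qed.

End Regular.

(** * Laws given by structure constants *)

Section StructureConstants.
Variables (K : fieldType) (N : nat).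
Notation index := ('I_N.+1 * 'I_N.+1 * 'I_N.+1)%type.
Notation E i := (delta_mx 0 i : 'rV[K]_N.+1).
Implicit Types (a : affine_space K index) (u v : 'rV[K]_N.+1).

Definition sc_mul a u v : 'rV[K]_N.+1 :=
  \row_k \sum_i \sum_j u 0 i * v 0 j * a (i, j, k).

Lemma sc_mul_bilinear a : bilinear_for *:%R *:%R (sc_mul a).
Proof.
split=> [v c u1 u2|u c v1 v2]; apply/rowP => k; rewrite !mxE.
  rewrite mulr_sumr -big_split /=; apply: eq_bigr => i _.
  rewrite mulr_sumr -big_split /=; apply: eq_bigr => j _.
  by rewrite !mxE; ring.
rewrite mulr_sumr -big_split /=; apply: eq_bigr => i _.
rewrite mulr_sumr -big_split /=; apply: eq_bigr => j _.
by rewrite !mxE; ring.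
Qed.

HB.instance Definition _ a := bilinear_isBilinear.Build K 'rV[K]_N.+1
  'rV[K]_N.+1 'rV[K]_N.+1 _ _ (sc_mul a) (sc_mul_bilinear a).

Lemma sc_mul_delta a i j k : sc_mul a (E i) (E j) 0 k = a (i, j, k).
Proof.
rewrite mxE (bigD1 i) //= [X in _ + X]big1 ?addr0 => [|i' i'i].
  rewrite (bigD1 j) //= [X in _ + X]big1 ?addr0 => [|j' j'j].
    by rewrite !mxE !eqxx !mul1r.
  by rewrite !mxE !eqxx (negbTE j'j) mulr0 mul0r.
by apply: big1 => j' _; rewrite !mxE !eqxx (negbTE i'i) !mul0r.
Qed.

Lemma structure_constantsK (mu : {bilinear 'rV[K]_N.+1 -> 'rV[K]_N.+1 -> 'rV[K]_N.+1})
    u v : sc_mul (structure_constants mu) u v = mu u v.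
Proof.
rewrite [u in RHS]row_sum_delta [v in RHS]row_sum_delta.
rewrite linear_sumlz; apply/rowP => k; rewrite mxE summxE.
apply: eq_bigr => i _; rewrite linear_sumr summxE.
apply: eq_bigr => j _; rewrite linearZl_LR linearZr_LR /= !mxE /= ffunE /=.
by rewrite mulrA.
Qed.

Lemma sc_mulK a : structure_constants (sc_mul a) = a.
Proof. by apply/ffunP => -[[i j] k]; rewrite ffunE sc_mul_delta. Qed.

Lemma Leib_mul a : Leib K N.+1 a -> leibniz_law (sc_mul a).
Proof.
by move=> [mu muL <-] u v z /=; rewrite !structure_constantsK muL.
Qed.

Lemma linear_delta_eq0 (f : 'rV[K]_N.+1 -> 'rV[K]_N.+1) :
  linear f -> (forall i, f (E i) = 0) -> forall u, f u = 0.
Proof.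
move=> flin f0 u.
pose g : {linear 'rV[K]_N.+1 -> 'rV[K]_N.+1} :=
  HB.pack f (GRing.isLinear.Build _ _ _ _ f flin).
rewrite -[f]/(g : _ -> _) [u]row_sum_delta linear_sum big1 // => j _.
by rewrite linearZ /= f0 scaler0.
Qed.

Lemma leibniz_law_delta (mu : {bilinear 'rV[K]_N.+1 -> 'rV[K]_N.+1 -> 'rV[K]_N.+1}) :
  (forall i j k, mu (E i) (mu (E j) (E k)) =
     mu (mu (E i) (E j)) (E k) - mu (mu (E i) (E k)) (E j)) ->
  leibniz_law mu.
Proof.
move=> muE.
have PL c x y w : mu (c *: x + y) w = c *: mu x w + mu y w.
  by rewrite linearDl linearZl_LR.
have PR c x y w : mu w (c *: x + y) = c *: mu w x + mu w y by rewrite linearP.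
pose J u v z := mu u (mu v z) - (mu (mu u v) z - mu (mu u z) v).
suff J0 u v z : J u v z = 0 by move=> u v z; apply/eqP; rewrite -subr_eq0 -/(J u v z) J0.
move: u; apply: linear_delta_eq0 => [c x y|i].
  by rewrite /J !PL; apply/rowP => k; rewrite !mxE; ring.
move: v; apply: linear_delta_eq0 => [c x y|j].
  by rewrite /J !PL !PR !PL; apply/rowP => k; rewrite !mxE; ring.
move: z; apply: linear_delta_eq0 => [c x y|k].
  by rewrite /J !PR !PL; apply/rowP => k; rewrite !mxE; ring.
by rewrite /J muE subrr.
Qed.

End StructureConstants.

(** * Weights on a path with labelled edges *)

Section WeightedPath.
Local Open Scope nat_scope.
Variables (m : nat) (w : bitseq).

(** Index 0 is the semisimple element, the vertices are 1, ..., m, the index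
m + a is the edge between the vertices a and a + 1, and the indices beyond
m + size w are isolated. *)
Definition is_edge k := m < k <= m + size w.
Definition lie_index k := (0 < k <= m) || (is_edge k && nth false w (k - m.+1)).
(** The vertices and the isolated indices have distinct powers of 6 as weights,
and an edge has the sum of the weights of its ends. As 6 = 1 mod 5, the
residue mod 5 of a sum of at most four powers counts its terms, which separates
edges from the other indices. *)
Definition weight k :=
  if k == 0 then 0 else
  if is_edge k then 6 ^ (k - m) + 6 ^ (k - m).+1 else 6 ^ k.
Definition adjacent i j :=
  [&& 0 < minn i j, maxn i j == (minn i j).+1 & minn i j <= size w].

Lemma pow6_mod5 k : 6 ^ k %% 5 = 1.
Proof. by rewrite -modnXm exp1n. Qed.

Lemma weight_mod5 k :
  weight k %% 5 = if k == 0 then 0 else if is_edge k then 2 else 1.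
Proof.
rewrite /weight; case: eqP => // _; case: ifP => _; last exact: pow6_mod5.
by rewrite -modnDm !pow6_mod5.
Qed.

Lemma weight_eq0 k : (weight k == 0) = (k == 0).
Proof.
rewrite /weight; have [//|k0] := eqVneq k 0.
by case: ifP => _; rewrite ?addn_eq0 !expn_eq0.
Qed.

Lemma pow6_inj : injective (fun k => 6 ^ k).
Proof. by move=> i j /eqP; rewrite eqn_exp2l // => /eqP. Qed.

Lemma pow6_sum_inj i j a b : i <= j -> a <= b ->
  6 ^ i + 6 ^ j = 6 ^ a + 6 ^ b -> i = a /\ j = b.
Proof.
suff le_top i' j' a' b' : i' <= j' -> a' <= b' ->
    6 ^ i' + 6 ^ j' = 6 ^ a' + 6 ^ b' -> b' <= j'.
  move=> ij ab e; have jb : j = b.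
    by apply/eqP; rewrite eqn_leq (le_top _ _ _ _ ab ij (esym e)) (le_top _ _ _ _ ij ab e).
  by subst b; move/eqP: e; rewrite eqn_add2r eqn_exp2l // => /eqP.
move=> ij ab e; rewrite leqNgt; apply/negP => jb.
have : 6 ^ i' <= 6 ^ j' by rewrite leq_pexp2l.
have : 6 ^ j'.+1 <= 6 ^ b' by rewrite leq_pexp2l.
have : 0 < 6 ^ j' by rewrite expn_gt0.
rewrite expnS; lia.
Qed.

Lemma weight_inj : injective weight.
Proof.
move=> i j e; have := congr1 (modn^~ 5) e; rewrite /= !weight_mod5.
move: e; rewrite /weight; case: (eqVneq i 0) => [->|i0];
  case: (eqVneq j 0) => [-> //|j0].
- by case: ifP.
- by case: ifP.
- case: ifP => Ei; case: ifP => Ej // e _; last exact: pow6_inj e.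
  move: Ei Ej; rewrite /is_edge; have [] := pow6_sum_inj (leqnSn _) (leqnSn _) e.
  lia.
Qed.

Hypothesis wm : size w <= m.-1.

(** The only additive relations between nonzero weights are the ones that define
the weights of the edges. Modulo 5, i and j must have weight 1 and k weight 2;
then the uniqueness of the expansion in base 6 applies. *)
Lemma weight_sumP i j k : i != 0 -> j != 0 -> k != 0 ->
  (weight i + weight j == weight k) = adjacent i j && (k == m + minn i j).
Proof.
move=> i0 j0 k0; apply/eqP/andP => [e|[/and3P[ij0 /eqP ijM ijw] /eqP ->]].
  have := congr1 (modn^~ 5) e; rewrite /= -modnDm !weight_mod5.
  rewrite (negbTE i0) (negbTE j0) (negbTE k0).
  move: e; rewrite /weight (negbTE i0) (negbTE j0) (negbTE k0).
  case: ifP => Ei; case: ifP => Ej; case: ifP => Ek //.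
  move: Ek; rewrite /is_edge /adjacent => Ek e _.
  have [ij|ji] := leqP i j.
    have [? ?] := pow6_sum_inj ij (leqnSn _) e; lia.
  rewrite addnC in e; have [? ?] := pow6_sum_inj (ltnW ji) (leqnSn _) e; lia.
rewrite /weight (negbTE i0) (negbTE j0) addn_eq0.
rewrite /is_edge; do ![case: ifP => ?]; try lia.
rewrite (_ : m + minn i j - m = minn i j); last lia.
have [ij|ji] := leqP i j.
  by have -> : j = i.+1 by lia.
by rewrite addnC; have -> : i = j.+1 by lia.
Qed.

End WeightedPath.

Section Recovery.
Local Open Scope nat_scope.

(** Injectivity prevents the walk s 1, ..., s (p+1) along the path from turning
around. It is monotone and stays within 1, ..., p + 1, so its starting point is
one of the two ends. *)
Lemma path_rigidity p (s b : nat -> nat) :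
  (forall i j, 0 < i <= p.+1 -> 0 < j <= p.+1 -> s i = s j -> i = j) ->
  (forall a, 0 < a <= p -> 0 < b a <= p /\
     ((s a = b a /\ s a.+1 = (b a).+1) \/ (s a = (b a).+1 /\ s a.+1 = b a))) ->
  (forall a, 0 < a <= p -> b a = a) \/ (forall a, 0 < a <= p -> b a = p.+1 - a).
Proof.
case: p => [|p] sinj sb; first by left; case.
have [b1 [[s1 s2]|[s1 s2]]] := sb 1 isT; [left|right].
  have up a : a <= p -> s a.+1 = b 1 + a /\ s a.+2 = (b 1 + a).+1.
    elim: a => [|a IH] ap; first by rewrite addn0.
    have [s3 s4] := IH (ltnW ap); have [b3 [[]|[s5 s6]]] := sb a.+2 ap; first lia.
    have : a.+3 = a.+1 by apply: sinj; lia.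
    lia.
  have [_ sp] := up p (leqnn _); have [bp sbp] := sb p.+1 (leqnn _).
  move=> [//|a] ap; have [sa sa'] := up a ap; have [? ?] := sb a.+1 ap; lia.
have down a : a <= p -> s a.+1 + a = (b 1).+1 /\ s a.+2 + a = b 1.
  elim: a => [|a IH] ap; first by rewrite !addn0.
  have [s3 s4] := IH (ltnW ap); have [b3 [[s5 s6]|[]]] := sb a.+2 ap; last lia.
  have : a.+3 = a.+1 by apply: sinj; lia.
  lia.
have [_ sp] := down p (leqnn _); have [bp sbp] := sb p.+1 (leqnn _).
move=> [//|a] ap; have [sa sa'] := down a ap; have [? ?] := sb a.+1 ap; lia.
Qed.

Lemma card_ord_interval N a b : a <= b <= N ->
  #|[pred k : 'I_N.+1 | a < k <= b]| = b - a.
Proof.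
move=> /andP[ab bN]; pose f (i : 'I_(b - a)) : 'I_N.+1 := inord (a.+1 + i).
have fE i : f i = a.+1 + i :> nat by rewrite /f inordK //; have := ltn_ord i; lia.
have finj : injective f by move=> i j /(congr1 val) /=; rewrite !fE => /addnI/val_inj.
rewrite -[RHS]card_ord -(card_imset _ finj); apply: eq_card => k; rewrite inE.
apply/idP/imsetP => [ak|[i _ ->]]; last by rewrite fE; have := ltn_ord i; lia.
have kab : k - a.+1 < b - a by lia.
by exists (Ordinal kab) => //; apply/val_inj; rewrite /= fE /=; lia.
Qed.

Variables (N : nat) (m m' : nat) (w w' : bitseq) (s : 'I_N.+1 -> 'I_N.+1).
Hypotheses (wm : size w <= m.-1) (wm' : size w' <= m'.-1).
Hypotheses (mwN : m + size w <= N) (mwN' : m' + size w' <= N).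
Hypothesis sinj : injective s.
Hypothesis s_weight : forall i j k : 'I_N.+1,
  (weight m' w' i + weight m' w' j == weight m' w' k) =
  (weight m w (s i) + weight m w (s j) == weight m w (s k)).
Hypothesis s_lie : forall k : 'I_N.+1, k != ord0 ->
  lie_index m' w' k = lie_index m w (s k).

Let s0 (k : 'I_N.+1) : (s k == ord0) = (k == ord0).
Proof.
suff s00 : s ord0 = ord0 by rewrite -[X in _ == X]s00 (inj_eq sinj).
have := s_weight ord0 ord0 ord0; rewrite eqxx => /esym/eqP e.
by apply/eqP; rewrite -val_eqE /= -(weight_eq0 m w); lia.
Qed.

Let edgeP M W (k : 'I_N.+1) : size W <= M.-1 -> M + size W <= N ->
  is_edge M W k =
  [exists i : 'I_N.+1, exists j : 'I_N.+1, [&& i != ord0, j != ord0, k != ord0 &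
     weight M W i + weight M W j == weight M W k]].
Proof.
move=> WM WN; apply/idP/existsP => [kE|[i /existsP[j /and4P[i0 j0 k0]]]].
  exists (inord (k - M)); apply/existsP; exists (inord (k - M).+1).
  move: kE; rewrite /is_edge => kE; rewrite -!val_eqE /= !inordK; try lia.
  rewrite weight_sumP ?/adjacent //; lia.
by rewrite weight_sumP // /adjacent /is_edge; lia.
Qed.

Let s_edge (k : 'I_N.+1) : is_edge m' w' k = is_edge m w (s k).
Proof.
have [t ts st] := injF_bij sinj.
rewrite !edgeP //; apply/existsP/existsP => -[i /existsP[j]].
  rewrite s_weight -(s0 i) -(s0 j) -(s0 k) => ijk.
  by exists (s i); apply/existsP; exists (s j).
rewrite -(st i) -(st j) -s_weight !s0 => ijk.
by exists (t i); apply/existsP; exists (t j).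
Qed.

Let card_s (P P' : pred nat) : (forall k : 'I_N.+1, P' k = P (s k)) ->
  #|[pred k : 'I_N.+1 | P' k]| = #|[pred k : 'I_N.+1 | P k]|.
Proof.
move=> PP; rewrite -(card_imset _ sinj); apply: eq_card => k; rewrite inE.
have [t ts st] := injF_bij sinj.
apply/imsetP/idP => [[i iP ->]|Pk]; first by move: iP; rewrite inE PP.
by exists (t k); rewrite ?inE ?PP ?st.
Qed.

(** The permutation s preserves the index 0, the edges (the nonzero indices whose
weight is a sum of two nonzero weights) and the vertices (the indices of Lie
type that are not edges). Counting gives p and m, and [path_rigidity] gives the
order of the edges up to reversal; the letters of the words are the types of the
edges. *)
Lemma code_recovery : m' = m /\ (w' = w \/ w' = rev w).
Proof.
have szw : size w' = size w.
  have := card_s s_edge; rewrite !card_ord_interval; lia.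
have mm : m' = m.
  have vertexE M W (k : nat) : size W <= M.-1 ->
      (0 < k <= M) = [&& k != 0, lie_index M W k & ~~ is_edge M W k].
    by move=> WM; rewrite /lie_index /is_edge; lia.
  have sv (k : 'I_N.+1) : (0 < k <= m') = (0 < s k <= m).
    rewrite (vertexE m' w') // (vertexE m w) // s_edge.
    have := s0 k; rewrite -!val_eqE /= => ->; case: eqP => //= /eqP k0.
    by rewrite s_lie.
  have := @card_s (fun k => 0 < k <= m) (fun k => 0 < k <= m') sv.
  rewrite !card_ord_interval; lia.
split=> //; subst m'.
pose sn k := s (inord k) : nat.
pose b a := sn (m + a) - m.
have bP a : 0 < a <= size w -> [/\ sn (m + a) = m + b a, 0 < b a <= size w &
    ((sn a = b a /\ sn a.+1 = (b a).+1) \/ (sn a = (b a).+1 /\ sn a.+1 = b a))].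
  move=> ap; have k0 : inord (m + a) != ord0 :> 'I_N.+1.
    by rewrite -val_eqE /= inordK; lia.
  have a0 : inord a != ord0 :> 'I_N.+1 by rewrite -val_eqE /= inordK; lia.
  have a0' : inord a.+1 != ord0 :> 'I_N.+1 by rewrite -val_eqE /= inordK; lia.
  have sn0 x : x != ord0 -> (s x : nat) != 0 by rewrite -s0 -val_eqE.
  have := s_weight (inord a) (inord a.+1) (inord (m + a)).
  rewrite !weight_sumP ?sn0 //; rewrite !inordK; try lia.
  rewrite /adjacent -/(sn a) -/(sn a.+1) -/(sn (m + a)) /b.
  move: (sn a) (sn a.+1) (sn (m + a)) => x y z.
  have -> : [&& 0 < minn a a.+1, maxn a a.+1 == (minn a a.+1).+1 &
    minn a a.+1 <= size w'] && (m + a == m + minn a a.+1) by lia.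
  by case/esym/andP => /and3P[x0 /eqP xy xw] /eqP ->; split; lia.
have letter i : i < size w -> nth false w' i = nth false w (b i.+1 - 1).
  move=> iw; have [snE bw _] := bP i.+1 iw.
  have k0 : inord (m + i.+1) != ord0 :> 'I_N.+1.
    by rewrite -val_eqE /= inordK; lia.
  have := s_lie k0; rewrite /lie_index -/(sn (m + i.+1)) snE /is_edge szw inordK; last lia.
  rewrite (_ : (0 < m + i.+1 <= m) = false); last lia.
  rewrite (_ : (0 < m + b i.+1 <= m) = false); last lia.
  rewrite (_ : (m < m + i.+1 <= m + size w)); last lia.
  rewrite (_ : (m < m + b i.+1 <= m + size w)); last lia.
  have e1 : m + i.+1 - m.+1 = i by lia.
  have e2 : m + b i.+1 - m.+1 = b i.+1 - 1 by lia.
  by rewrite /= e1 e2.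
have := @path_rigidity (size w) sn b.
case=> [i j ip jp /val_inj/sinj/(congr1 val) /=|a ap|bE|bE].
(* For p = 0 and m = 0 the index p + 1 is not a vertex, but then i = j = 1. *)
- have [p0|p0] := posnP (size w); first by move=> _; lia.
  by rewrite !inordK //; lia.
- by have [] := bP a ap.
- left; apply: (@eq_from_nth _ false) => // i; rewrite szw => iw.
  by rewrite letter // bE // subSS subn0.
- right; apply: (@eq_from_nth _ false) => [|i]; first by rewrite size_rev.
  rewrite szw => iw; rewrite nth_rev // letter // bE // subSS.
  by congr nth; lia.
Qed.

End Recovery.

(** * Simple spectrum of a right multiplication *)

Notation index N := ('I_N.+1 * 'I_N.+1 * 'I_N.+1)%type.

Section RightMultiplication.
Variables (K : closedFieldType) (N : nat).
Notation E i := (delta_mx 0 i : 'rV[K]_N.+1).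
Implicit Types (a : affine_space K (index N)) (t : 'I_N.+1 -> K).

Definition right_mul0 a : 'M[K]_N.+1 := \matrix_(i, k) a (i, ord0, k).

Lemma right_mul0E a u : u *m right_mul0 a = sc_mul a u (E ord0).
Proof.
apply/rowP => k; rewrite !mxE; apply: eq_bigr => i _.
rewrite (bigD1 ord0) //= big1 ?addr0 => [|j j0]; first by rewrite !mxE !eqxx mulr1.
by rewrite !mxE (negbTE j0) andbF mulr0 mul0r.
Qed.

(** The product over j <> i of (A - t_j) projects, up to a scalar, to the
eigenspace of t_i. The eigenvectors obtained in this way depend polynomially on
A and t, and they are nonzero as long as the row of ones has a nonzero component
in each eigenspace. *)
Definition eigenvec (A : 'M[K]_N.+1) t i : 'rV[K]_N.+1 :=
  const_mx 1 *m horner_mx A (\prod_(j | j != i) ('X - (t j)%:P)).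

Section SimpleSpectrum.
Variables (A : 'M[K]_N.+1) (t : 'I_N.+1 -> K).
Hypothesis tinj : injective t.
Hypothesis troot : forall i, root (char_poly A) (t i).

Lemma char_poly_simple : char_poly A = \prod_i ('X - (t i)%:P).
Proof.
have tall : all (root (char_poly A)) (codom t).
  by apply/allP => _ /codomP[i ->].
have tuniq : uniq_roots (codom t) by rewrite uniq_rootsE map_inj_uniq ?enum_uniq.
have tsize : size (char_poly A) = (size (codom t)).+1.
  by rewrite size_char_poly size_codom card_ord.
rewrite (all_roots_prod_XsubC tsize tall tuniq) (monicP (char_poly_monic A)).
by rewrite scale1r big_image.
Qed.

Lemma root_simple r : root (char_poly A) r -> exists i, r = t i.
Proof.
have -> : char_poly A = \prod_(z <- codom t) ('X - z%:P).
  by rewrite char_poly_simple big_image.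
by rewrite root_prod_XsubC => /codomP.
Qed.

Lemma eigenvecP i : eigenvec A t i *m A = t i *: eigenvec A t i.
Proof.
apply/eqP; rewrite -subr_eq0 -mul_mx_scalar -mulmxBr.
have -> : A - (t i)%:M = horner_mx A ('X - (t i)%:P).
  by rewrite rmorphB /= horner_mx_X horner_mx_C.
rewrite /eigenvec -mulmxA -[X in _ *m X]/(_ * _) -rmorphM /= mulrC.
have -> : ('X - (t i)%:P) * \prod_(j | j != i) ('X - (t j)%:P) = char_poly A.
  by rewrite char_poly_simple [RHS](bigD1 i).
by rewrite Cayley_Hamilton mulmx0.
Qed.

Lemma eigenspace_line i (d e : 'rV[K]_N.+1) : d != 0 ->
  d *m A = t i *: d -> e *m A = t i *: e -> exists c, e = c *: d.
Proof.
move=> d0 /eigenspaceP dA /eigenspaceP eA.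
have dir : mxdirect (\sum_(j | true) eigenspace A (t j))%MS.
  by apply: mxdirect_sum_eigenspace => j k _ _; apply: tinj.
have rank1 j : (0 < \rank (eigenspace A (t j)))%N.
  by rewrite lt0n mxrank_eq0; have := troot j; rewrite -eigenvalue_root_char.
have ranki : (\rank (eigenspace A (t i)) <= 1)%N.
  have := rank_leq_row (\sum_(j | true) eigenspace A (t j))%MS.
  rewrite (mxdirectP dir) /= (bigD1 i) //=.
  have : (\sum_(j < N.+1 | j != i) 1 <= \sum_(j | j != i) \rank (eigenspace A (t j)))%N.
    by apply: leq_sum.
  by rewrite sum1_card cardC1 card_ord /=; lia.
apply/sub_rVP; apply: submx_trans eA _.
have [_] := mxrank_leqif_sup dA; rewrite rank_rV d0 => <-.
by rewrite eqn_leq ranki rank1.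
Qed.

End SimpleSpectrum.
End RightMultiplication.

(** * The law attached to a code *)

Section Model.
Variables (K : numClosedFieldType) (N m : nat) (w : bitseq).
Notation weight := (weight m w).
Notation E i := (delta_mx 0 i : 'rV[K]_N.+1).
Notation lie_index := (lie_index m w).
Notation adjacent := (adjacent w).

Definition prod_index (i j : nat) : nat :=
  if j == 0%N then i else if i == 0%N then j else (m + minn i j)%N.

(** The product of the vertices i and j that span an edge f of Lie type is
antisymmetric. If f lies in the ideal of squares, then e_0 f = 0, and the
Leibniz identity for e_0, e_i, e_j requires the products e_i e_j and e_j e_i to be
in the ratio of the weights of j and i. *)
Definition model_coef (i j : nat) : K :=
  if j == 0%N then (weight i)%:R else
  if i == 0%N then (if lie_index j then - (weight j)%:R else 0) else
  if adjacent i j then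
    (if nth false w (minn i j).-1 then (-1) ^+ (j < i)%N else (weight j)%:R)
  else 0.

Definition model : affine_space K (index N) :=
  [ffun ijk : index N => if ijk.2 == inord (prod_index ijk.1.1 ijk.1.2)
               then model_coef ijk.1.1 ijk.1.2 else 0].

Lemma model_delta (i j : 'I_N.+1) :
  sc_mul model (E i) (E j) = model_coef i j *: E (inord (prod_index i j)).
Proof.
apply/rowP => k; rewrite sc_mul_delta ffunE /= !mxE eqxx /=.
by case: eqP => _; rewrite ?mulr1 ?mulr0.
Qed.

Hypothesis wm : (size w <= m.-1)%N.
Hypothesis mwN : (m + size w <= N)%N.

Lemma prod_index_le (i j : 'I_N.+1) : model_coef i j != 0 -> (prod_index i j <= N)%N.
Proof.
rewrite /model_coef /prod_index; case: ifP => _; first by have := ltn_ord i; lia.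
case: ifP => _; first by have := ltn_ord j; lia.
by case: ifP => [|_]; rewrite ?eqxx // /adjacent; lia.
Qed.

Lemma model_coef_weight (i j : nat) : model_coef i j != 0 ->
  weight (prod_index i j) = (weight i + weight j)%N.
Proof.
rewrite /model_coef /prod_index; have [->|j0] := eqVneq j 0%N.
  by rewrite /weight /= addn0.
have [->|i0] := eqVneq i 0%N; first by rewrite /weight /= add0n.
case: ifP => [adj _|]; last by rewrite eqxx.
apply/esym/eqP; rewrite weight_sumP //; first by rewrite adj eqxx.
by move: adj; rewrite /adjacent; lia.
Qed.

Lemma adjacent_sym i j : adjacent i j = adjacent j i.
Proof. by rewrite /adjacent minnC maxnC. Qed.

Lemma prod_index_sym (i j : nat) : i != 0%N -> j != 0%N -> prod_index i j = prod_index j i.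
Proof. by rewrite /prod_index => /negbTE -> /negbTE ->; rewrite minnC. Qed.

(** The elements outside the Lie type annihilate everything on the right, as all
elements of the ideal spanned by the squares do. *)
Lemma model_coef_ideal (i k : nat) : k != 0%N -> lie_index k = false ->
  model_coef i k = 0.
Proof.
rewrite /model_coef => /negbTE -> kL; rewrite kL; case: ifP => // _; case: ifP => //.
by move: kL; rewrite /adjacent /lie_index; lia.
Qed.

(** Two-step nilpotency away from e_0: a product of vertices is an edge, and
edges have trivial products with everything but e_0. *)
Lemma model_coef_edge (i j k : nat) : i != 0%N -> j != 0%N -> k != 0%N ->
  model_coef j k != 0 ->
  model_coef i (prod_index j k) = 0 /\ model_coef (prod_index j k) i = 0.
Proof.
move=> i0 j0 k0; rewrite /model_coef /prod_index (negbTE i0) (negbTE j0) (negbTE k0).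
case: ifP => [adj _|]; last by rewrite eqxx.
have jk0 : (m + minn j k == 0)%N = false by lia.
rewrite jk0; split; rewrite ifF //; move: adj; rewrite /adjacent; lia.
Qed.

(** The Leibniz identity for e_0, e_j, e_k with j and k nonzero. *)
Lemma model_coef0_edge (j k : nat) : j != 0%N -> k != 0%N ->
  model_coef 0 (prod_index j k) * model_coef j k =
  model_coef 0 j * model_coef j k - model_coef 0 k * model_coef k j.
Proof.
move=> j0 k0; rewrite /model_coef /prod_index (negbTE j0) (negbTE k0) /=.
rewrite (adjacent_sym k j); have [adj|_] := boolP (adjacent j k); last first.
  by rewrite !mulr0 subr0.
have jk0 : (m + minn j k == 0)%N = false by lia.
have jL : lie_index j by move: adj; rewrite /adjacent /lie_index; lia.
have kL : lie_index k by move: adj; rewrite /adjacent /lie_index; lia.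
have tL : lie_index (m + minn j k) = nth false w (minn j k).-1.
  rewrite /lie_index /is_edge; move: adj; rewrite /adjacent => adj.
  have -> : (m + minn j k - m.+1 = (minn j k).-1)%N by lia.
  by case: nth; lia.
rewrite jk0 jL kL tL (minnC k j).
have tw : (weight j + weight k == weight (m + minn j k))%N.
  by rewrite weight_sumP ?adj ?eqxx ?jk0.
rewrite -(eqP tw) natrD; case: ifP => _; last by ring.
have [jk|kj|jk] := ltngtP j k; rewrite ?expr0 ?expr1; [ring|ring|].
by move: adj; rewrite jk /adjacent; lia.
Qed.

Lemma model_coef_eq0_sym (j k : nat) : j != 0%N -> k != 0%N ->
  model_coef j k = 0 -> model_coef k j = 0.
Proof.
move=> j0 k0; rewrite /model_coef (negbTE j0) (negbTE k0) adjacent_sym.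
case: ifP => // _; rewrite minnC; case: ifP => _ /eqP.
  by rewrite signr_eq0.
by rewrite pnatr_eq0 weight_eq0 (negbTE k0).
Qed.

Lemma model_Leib : Leib K N.+1 model.
Proof.
exists (sc_mul model); last exact: sc_mulK.
apply: leibniz_law_delta => i j k /=.
rewrite !model_delta !linearZr_LR !linearZl_LR /= !model_delta.
have inordt (x y : 'I_N.+1) : model_coef x y != 0 ->
    (inord (prod_index x y) : 'I_N.+1) = prod_index x y :> nat.
  by move=> /prod_index_le xy; rewrite inordK.
rewrite !scalerA.
have g0 (x : 'I_N.+1) : model_coef x 0 = (weight x)%:R by [].
have tg0 (x : 'I_N.+1) : prod_index x 0 = x by [].
have [k0|k0] := eqVneq (k : nat) 0%N.
  rewrite k0 !g0 !tg0 !inord_val.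
  have [->|gij] := eqVneq (model_coef i j) 0; first by rewrite mulr0 !mul0r mulr0 !scale0r subr0.
  rewrite inordt // model_coef_weight // natrD -scalerBl; congr (_ *: _).
  by ring.
have [j0|j0] := eqVneq (j : nat) 0%N.
  rewrite j0 !g0 !tg0 !inord_val.
  have tk : prod_index 0 k = k by rewrite /prod_index (negbTE k0).
  rewrite tk inord_val.
  have [->|gik] := eqVneq (model_coef i k) 0; first by rewrite mulr0 !mul0r mulr0 !scale0r subr0.
  rewrite inordt // model_coef_weight // natrD -scalerBl; congr (_ *: _).
  have [kL|/negbTE kL] := boolP (lie_index k).
    by rewrite {1}/model_coef (negbTE k0) /= kL; ring.
  by move: gik; rewrite model_coef_ideal ?eqxx.
have tN0 : model_coef j k != 0 ->
    prod_index 0 (inord (prod_index j k) : 'I_N.+1) = prod_index j k.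
  by move=> gjk; rewrite inordt // {1}/prod_index; case: eqP.
have [i0|i0] := eqVneq (i : nat) 0%N.
  rewrite i0.
  have t0j : prod_index 0 j = j by rewrite /prod_index (negbTE j0).
  have t0k : prod_index 0 k = k by rewrite /prod_index (negbTE k0).
  rewrite t0j t0k !inord_val.
  have [gjk|gjk] := eqVneq (model_coef j k) 0.
    by rewrite gjk (model_coef_eq0_sym j0 k0 gjk) !mulr0 mul0r !scale0r subr0.
  rewrite tN0 // inordt // (prod_index_sym k0 j0) -scalerBl mulrC.
  by rewrite model_coef0_edge.
have z1 (x y z : 'I_N.+1) : (x : nat) != 0%N -> (y : nat) != 0%N -> (z : nat) != 0%N ->
    model_coef x y * model_coef (inord (prod_index x y) : 'I_N.+1) z = 0 /\
    model_coef x y * model_coef z (inord (prod_index x y) : 'I_N.+1) = 0.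
  move=> x0 y0 z0; have [->|gxy] := eqVneq (model_coef x y) 0; first by rewrite !mul0r.
  by rewrite inordt //; have [-> ->] := model_coef_edge z0 x0 y0 gxy; rewrite mulr0.
have [_ ->] := z1 j k i j0 k0 i0; have [-> _] := z1 i j k i0 j0 k0.
by have [-> _] := z1 i k j i0 k0 j0; rewrite !scale0r subr0.
Qed.

End Model.

(** * The open set attached to a code *)

Section Chart.
Variables (K : numClosedFieldType) (N m : nat) (w : bitseq).
Notation E i := (delta_mx 0 i : 'rV[K]_N.+1).
Notation weight := (weight m w).
Notation lie_index := (lie_index m w).
Notation adjacent := (adjacent w).
Notation model_coef := (model_coef K m w).
Implicit Types (t : seq K) (a : affine_space K (index N)).

Definition chart_eigenvec t a (i : 'I_N.+1) : 'rV[K]_N.+1 :=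
  eigenvec (right_mul0 a) (fun j => t`_j) i.
Notation ev := chart_eigenvec.

(** The four factors ask for distinct eigenvalues, for no additive relation
beyond those of the weights, for nonzero products of eigenvectors wherever the
model has them, and for e_0 e_i + e_i e_0 <> 0, an open condition that puts e_i
into the ideal of squares, when i is not of Lie type. That e_0 e_i <> 0 when i is
of Lie type is part of the third condition. Products are tested on the one
coordinate that is nonzero for the model. *)
Definition chart_factor (ijk : index N) t a : K :=
  let: (i, j, k) := ijk in
  (if i != j then t`_i - t`_j else 1)
  * (if (weight i + weight j)%N != weight k then t`_i + t`_j - t`_k else 1)
  * (if model_coef i j != 0
     then sc_mul a (ev t a i) (ev t a j) 0 (inord (prod_index m i j)) else 1)
  * (if (i != ord0) && ~~ lie_index i
     then sc_mul a (ev t a ord0) (ev t a i) 0 i + sc_mul a (ev t a i) (ev t a ord0) 0 i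
     else 1).

Definition chart : set (affine_space K (index N)) :=
  [set a | exists t, [/\ size t = N.+1, all (root (char_poly (right_mul0 a))) t &
     \prod_ijk chart_factor ijk t a != 0]].

Lemma regular_right_mul0 :
  mx_regular (fun (_ : seq K) a => right_mul0 a).
Proof.
move=> i j; apply: (regular_ext (g := fun _ a => a (i, ord0, j))) => [|t a].
  exact: regular_coord.
by rewrite mxE.
Qed.

Lemma regular_chart_eigenvec i : mx_regular (fun t a => ev t a i).
Proof.
apply: (mx_regularM (M1 := fun _ _ => const_mx 1)
  (M2 := fun t a => horner_mx (right_mul0 a) (\prod_(j | j != i) ('X - (t`_j)%:P)))).
  by move=> ? ?; apply: (regular_ext (g := fun _ _ => 1)) => [|t a];
    [apply: regular_cst|rewrite mxE].
apply: (mx_regular_ext (M2 := fun t a =>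
    \prod_(j | j != i) (right_mul0 a - (t`_j)%:M))) => [|t a].
  apply: mx_regular_prod => j p q.
  apply: (regular_ext (g := fun t a => right_mul0 a p q + - (t`_j * (p == q)%:R))).
    apply: regularD; first exact: regular_right_mul0.
    apply: regularN; apply: regularM; first exact: regular_var.
    exact: regular_cst.
  by move=> t a; rewrite !mxE mulr_natr.
rewrite rmorph_prod; apply: eq_bigr => j _.
by rewrite rmorphB /= horner_mx_X horner_mx_C.
Qed.

Lemma regular_sc_mul (u v : seq K -> affine_space K (index N) -> 'rV[K]_N.+1) :
  mx_regular u -> mx_regular v -> mx_regular (fun t a => sc_mul a (u t a) (v t a)).
Proof.
move=> ur vr i k; apply: (regular_ext (g := fun t a =>
    \sum_i \sum_j u t a 0 i * v t a 0 j * a (i, j, k))); last first.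
  by move=> t a; rewrite mxE.
apply: regular_sum => p _; apply: regular_sum => q _.
by apply: regularM; [apply: regularM|apply: regular_coord].
Qed.

Lemma open_chart : open chart.
Proof.
apply: open_exists_eigenvalues; first exact: regular_right_mul0.
apply: regular_prod => -[[i j] k].
have r1 : regular (fun (_ : seq K) (_ : affine_space K (index N)) => 1).
  exact: regular_cst.
have rv n : regular (fun t (_ : affine_space K (index N)) => t`_n).
  exact: regular_var.
have rm p q k' : regular (fun t a => sc_mul a (ev t a p) (ev t a q) 0 k').
  exact: (regular_sc_mul (regular_chart_eigenvec p) (regular_chart_eigenvec q)).
have rif (b : bool) f : regular f ->
    regular (fun t (a : affine_space K (index N)) => if b then f t a else 1).
  by case: b.
apply: regularM; first (apply: regularM; first apply: regularM); apply: rif => //.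
- by apply: regularD => //; apply: regularN.
- by apply: regularD; [apply: regularD|apply: regularN].
- exact: regularD.
Qed.

(** For the model, right multiplication by e_0 is diagonal with the weights as
entries, so the eigenvectors of [chart_eigenvec] are multiples of the basis. *)
Lemma model_chart : chart (model K N m w).
Proof.
set a := model K N m w.
pose t := [seq (weight i)%:R : K | i <- iota 0 N.+1].
have tE (i : 'I_N.+1) : t`_i = (weight i)%:R.
  by rewrite (nth_map 0%N) ?size_iota // nth_iota.
have eigE i : E i *m right_mul0 a = (weight i)%:R *: E i.
  by rewrite right_mul0E model_delta /prod_index /= inord_val.
have evE i : exists2 c, c != 0 & ev t a i = c *: E i.
  exists (\prod_(j | j != i) ((weight i)%:R - t`_j)).
    apply/prodf_neq0 => j ji; rewrite tE subr_eq0.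
    apply: contraNneq ji => /eqP; rewrite eqr_nat => /eqP/weight_inj/val_inj ->.
    exact: eqxx.
  rewrite /chart_eigenvec /eigenvec.
  have -> : const_mx 1 = \sum_k E k :> 'rV[K]_N.+1.
    by rewrite [LHS]row_sum_delta; apply: eq_bigr => k _; rewrite mxE scale1r.
  rewrite mulmx_suml (bigD1 i) //= [X in _ + X]big1 ?addr0 => [|k ki].
    rewrite (mul_horner_mx_eigenvector _ (eigE i)) horner_prod.
    by congr (_ *: _); apply: eq_bigr => j _; rewrite hornerXsubC.
  rewrite (mul_horner_mx_eigenvector _ (eigE k)) horner_prod.
  by rewrite (bigD1 k) //= hornerXsubC tE subrr mul0r scale0r.
exists t; split; first by rewrite size_map size_iota.
  apply/allP => x /mapP[p]; rewrite mem_iota add0n /= => pN ->.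
  rewrite -eigenvalue_root_char; apply/eigenvalueP.
  exists (E (Ordinal pN)); first by rewrite eigE.
  by apply/matrix0Pn; exists 0, (Ordinal pN); rewrite !mxE !eqxx oner_eq0.
apply/prodf_neq0 => -[[i j] k] _; rewrite /chart_factor !mulf_neq0 //.
- case: ifP => [ij|_]; last by rewrite oner_eq0.
  rewrite !tE subr_eq0; apply: contraNneq ij => /eqP.
  rewrite eqr_nat => /eqP/weight_inj/val_inj ->.
  exact: eqxx.
- case: ifP => [ijk|_]; last by rewrite oner_eq0.
  by rewrite !tE subr_eq0 -natrD eqr_nat.
- case: ifP => [ij|_]; last by rewrite oner_eq0.
  have [c c0 ->] := evE i; have [d d0 ->] := evE j.
  rewrite linearZl_LR linearZr_LR /= model_delta !mxE !eqxx mulr1.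
  by rewrite !mulf_neq0.
- case: ifP => [/andP[i0 iL]|_]; last by rewrite oner_eq0.
  have [c c0 ->] := evE i; have [d d0 ->] := evE ord0.
  rewrite !linearZl_LR !linearZr_LR /= !model_delta !mxE !eqxx.
  rewrite {1}/model_coef /= (negbTE iL) -[(i : nat) == 0%N]/(i == ord0) (negbTE i0).
  rewrite mul0r !mulr0 add0r /prod_index /= inord_val eqxx mulr1.
  by rewrite !mulf_neq0 // /model_coef /= pnatr_eq0 weight_eq0.
Qed.

(** An intrinsic form of the Lie type, which refers neither to the code nor to an
ordering of the spectrum. *)
Definition right_acting a (r : K) : Prop :=
  exists e u, e *m right_mul0 a = r *: e /\ sc_mul a u e != 0.

(** The Leibniz identity enters in two ways. Right multiplication by e_0 is a
derivation, so a nonzero product e_i e_j is an eigenvector for t_i + t_j; this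
sum is some t_l, and the absence of further relations identifies l. And right
multiplication by x y + y x is zero, so if e_0 e_i + e_i e_0 <> 0, this vector spans
the eigenspace of t_i and acts trivially on the right. *)
Lemma chart_spectrum a : (size w <= m.-1)%N -> (0 < N)%N ->
  Leib K N.+1 a -> chart a ->
  exists t : 'I_N.+1 -> K, [/\ injective t,
    forall i, root (char_poly (right_mul0 a)) (t i),
    forall i j k : 'I_N.+1,
      (t i + t j == t k) = (weight i + weight j == weight k)%N &
    forall i : 'I_N.+1, i != ord0 -> lie_index i <-> right_acting a (t i)].
Proof.
move=> wm N0 /Leib_mul/= aL [s [sN sroot /prodf_neq0 sfac]].
pose t (i : 'I_N.+1) := s`_i; pose e i := eigenvec (right_mul0 a) t i.
have troot i : root (char_poly (right_mul0 a)) (t i).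
  by apply: (allP sroot); rewrite mem_nth ?sN.
have fac (i j k : 'I_N.+1) : [/\ i != j -> t i != t j,
    (weight i + weight j)%N != weight k -> t i + t j != t k,
    model_coef i j != 0 -> sc_mul a (e i) (e j) != 0 &
    (i != ord0) -> ~~ lie_index i ->
      sc_mul a (e ord0) (e i) + sc_mul a (e i) (e ord0) != 0].
  have := sfac (i, j, k) isT; rewrite /chart_factor !mulf_eq0 !negb_or.
  rewrite -/(t i) -/(t j) -/(t k) -/(e i) -/(e j) -/(e ord0).
  case/andP => /andP[/andP[f1 f2] f3] f4; split.
  - by move=> ij; move: f1; rewrite ij subr_eq0.
  - by move=> ijk; move: f2; rewrite ijk subr_eq0.
  - by move=> ij; move: f3; rewrite ij; apply: contraNneq => ->; rewrite mxE.
  - move=> i0 iL; move: f4; rewrite i0 iL /=; apply: contraNneq => e0.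
    by move/rowP/(_ i): e0; rewrite !mxE => ->.
have tinj : injective t.
  move=> i j tij; apply/eqP/negPn/negP => ij.
  by have [/(_ ij)] := fac i j i; rewrite tij eqxx.
have eA i : e i *m right_mul0 a = t i *: e i by exact: eigenvecP.
have derA u v : sc_mul a u v *m right_mul0 a =
    sc_mul a (u *m right_mul0 a) v + sc_mul a u (v *m right_mul0 a).
  by rewrite !right_mul0E aL addrC subrK.
have mulA u v r q : u *m right_mul0 a = r *: u -> v *m right_mul0 a = q *: v ->
    sc_mul a u v *m right_mul0 a = (r + q) *: sc_mul a u v.
  by move=> uA vA; rewrite derA uA vA linearZl_LR linearZr_LR /= scalerDl.
have arrow (i j k : 'I_N.+1) : model_coef i j != 0 ->
    (weight i + weight j = weight k)%N -> t i + t j = t k.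
  move=> gij wijk; have [_ _ /(_ gij) eij _] := fac i j k.
  (* The spectrum is exactly the t_l, so t_i + t_j is one of them. *)
  have [|l tl] := @root_simple _ _ (right_mul0 a) t tinj troot (t i + t j).
    rewrite -eigenvalue_root_char; apply/eigenvalueP.
    by exists (sc_mul a (e i) (e j)) => //; apply: mulA.
  suff -> : k = l by [].
  apply/val_inj/(@weight_inj m w); rewrite -wijk; apply/eqP/negPn/negP => wl.
  by have [_ /(_ wl)] := fac i j l; rewrite tl eqxx.
have g0 (i : 'I_N.+1) : i != ord0 -> model_coef i (ord0 : 'I_N.+1) != 0.
  by move=> i0; rewrite /model_coef /= pnatr_eq0 weight_eq0.
(* e_N e_0 <> 0 forces t_N + t_0 = t_N. *)
have t0 : t ord0 = 0.
  have := arrow ord_max ord0 ord_max (g0 _ _); rewrite -val_eqE /= => t0.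
  by apply: (@addrI _ (t ord_max)); rewrite addr0 t0 // -?lt0n // /weight addn0.
exists t; split=> // [i j k|i i0].
  apply/idP/idP => [tijk|/eqP wijk].
    by apply/negPn/negP => wijk; have [_ /(_ wijk)] := fac i j k; rewrite tijk.
  have [i0|i0] := eqVneq i ord0.
    move: wijk; rewrite i0 t0 add0r => /(@weight_inj m w)/val_inj ->.
    exact: eqxx.
  have [j0|j0] := eqVneq j ord0.
    move: wijk; rewrite j0 t0 addr0 addn0 => /(@weight_inj m w)/val_inj ->.
    exact: eqxx.
  have k0 : k != ord0.
    apply: contra_neq i0 => k0; apply/eqP; rewrite -val_eqE /= -(weight_eq0 m w).
    have wk : weight k = 0%N by rewrite k0.
    by move: wijk; rewrite wk; lia.
  have := weight_sumP wm (i := i) (j := j) (k := k); rewrite wijk eqxx.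
  move=> /(_ i0 j0 k0)/esym/andP[ij _].
  apply/eqP/arrow => //; rewrite /model_coef -[(j : nat) == 0%N]/(j == ord0) (negbTE j0).
  rewrite -[(i : nat) == 0%N]/(i == ord0) (negbTE i0) ij.
  by case: ifP => _; rewrite ?signr_eq0 // pnatr_eq0 weight_eq0.
split=> [iL|[v [u [vA uv]]]].
  exists (e i), (e ord0); split=> //.
  have [_ _ + _] := fac ord0 i ord0; apply.
  rewrite /model_coef -[(i : nat) == 0%N]/(i == ord0) (negbTE i0) /= iL oppr_eq0.
  by rewrite pnatr_eq0 weight_eq0.
apply/negPn/negP => iL; have [_ _ _ /(_ i0 iL) d0] := fac i i i.
set d := _ + _ in d0.
have dA : d *m right_mul0 a = t i *: d.
  rewrite mulmxDl (mulA _ _ _ _ (eA _) (eA _)) (mulA _ _ _ _ (eA _) (eA _)).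
  by rewrite t0 add0r addr0 -scalerDr.
have ud : sc_mul a u d = 0.
  by rewrite linearDr /= !aL addrA subrK subrr.
have [c vd] := eigenspace_line tinj troot d0 dA vA.
by move: uv; rewrite vd linearZr_LR /= ud scaler0 eqxx.
Qed.

End Chart.

(** Both enumerations list the same spectrum, so they differ by a permutation of
the indices, to which [code_recovery] applies. *)
Lemma chart_disjoint (K : numClosedFieldType) (N m m' : nat) (w w' : bitseq) a :
  (0 < N)%N -> (size w <= m.-1)%N -> (size w' <= m'.-1)%N ->
  (m + size w <= N)%N -> (m' + size w' <= N)%N ->
  Leib K N.+1 a -> chart m w a -> chart m' w' a ->
  m' = m /\ (w' = w \/ w' = rev w).
Proof.
move=> N0 wm wm' mwN mwN' aL ac ac'.
have [t [tinj troot tw tlie]] := chart_spectrum wm N0 aL ac.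
have [t' [tinj' troot' tw' tlie']] := chart_spectrum wm' N0 aL ac'.
have /choice[s sE] i : exists j, t' i = t j by apply: root_simple (troot' i).
have sinj : injective s by move=> i j sij; apply: tinj'; rewrite !sE sij.
apply: (code_recovery wm wm' mwN mwN' sinj) => [i j k|k k0].
  by rewrite -tw' !sE tw.
have sk0 : s k != ord0.
  apply: contra_neq k0 => sk0; apply/eqP; rewrite -val_eqE /= -(weight_eq0 m' w').
  have := tw' k k k; rewrite !sE sk0 tw [_ == _]eqxx => /esym/eqP; lia.
apply/idP/idP => [/(tlie' _ k0)|/(tlie _ sk0)].
  by rewrite sE => /(tlie _ sk0).
by rewrite -sE => /(tlie' _ k0).
Qed.

(** * Codes and the number of components *)

Section Counting.
Variable (R : realType).
Notation C := (R[i] : numClosedFieldType).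

Definition valid_code N (d : nat * bitseq) :=
  ((size d.2 <= d.1.-1) && (d.1 + size d.2 <= N))%N.

Definition same_code (d d' : nat * bitseq) :=
  (d.1 == d'.1) && ((d.2 == d'.2) || (d.2 == rev d'.2)).

Lemma same_code_sym d d' : same_code d d' = same_code d' d.
Proof.
rewrite /same_code eq_sym [d'.2 == _]eq_sym; congr (_ && (_ || _)).
by rewrite -[in RHS](inj_eq (can_inj revK)) revK eq_sym.
Qed.

Lemma Leib_components_ge N (J : finType) (d : J -> nat * bitseq) :
  (0 < N)%N -> (forall j, valid_code N (d j)) ->
  (forall j k, same_code (d j) (d k) -> j = k) ->
  (#|J|%:R%:E <= num_irreducible_components R (Leib C N.+1))%E.
Proof.
move=> N0 dval dinj.
apply: (@num_irreducible_components_ge _ _ _ J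
  (fun j => model C N (d j).1 (d j).2) (fun j => chart (d j).1 (d j).2)).
- by move=> j; have /andP[? ?] := dval j; apply: model_Leib.
- by move=> j; apply: model_chart.
- by move=> j; apply: open_chart.
- move=> j k a aL aj ak; have /andP[? ?] := dval j; have /andP[? ?] := dval k.
  apply/esym/dinj; rewrite /same_code.
  have [] // := @chart_disjoint C N (d j).1 (d k).1 (d j).2 (d k).2 a.
  by move=> -> [->|->]; rewrite !eqxx ?orbT.
Qed.

(** The codes [(0, [::])] and [(1, [::])] are already enough. *)
Lemma Leib_reducible N : (0 < N)%N -> ~ irreducible (Leib C N.+1).
Proof.
move=> N0 Lirr.
pose d (b : bool) := ((b : nat), [::] : bitseq).
have dval b : valid_code N (d b) by case: b; rewrite /valid_code /= ?addn0.
suff: true = false by [].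
apply: (@irreducible_separated _ (Leib C N.+1) bool
  (fun j => model C N (d j).1 (d j).2) (fun j => chart (d j).1 (d j).2)
  _ _ _ (Leib C N.+1)) => //.
- by move=> j; apply: model_chart.
- by move=> j; apply: open_chart.
- move=> j k a aL aj ak; have /andP[? ?] := dval j; have /andP[? ?] := dval k.
  have [] // := @chart_disjoint C N (d j).1 (d k).1 (d j).2 (d k).2 a.
  by case: (j) (k) => -[].
- by have /andP[? ?] := dval true; apply: model_Leib.
- by have /andP[? ?] := dval false; apply: model_Leib.
Qed.

(** One representative, up to reversal, of each word of length at most 3. *)
Definition short_words : seq bitseq :=
  let o := false in let l := true in
  [:: [::]; [:: o]; [:: l]; [:: o; o]; [:: o; l]; [:: l; l];
      [:: o; o; o]; [:: o; o; l]; [:: o; l; o]; [:: o; l; l]; [:: l; o; l];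
      [:: l; l; l]].

(** A nonempty word of length p goes with m = p + 1, ..., N - p, so that all
indices up to m + p are available; without vertices only the empty word is left,
hence the code that is listed apart. *)
Definition short_codes N : seq (nat * bitseq) :=
  (0%N, [::]) ::
  [seq (m, w) | w <- short_words, m <- iota (size w).+1 (N - (size w).*2)].

Lemma Leib_components_short N : (0 < N)%N -> all (valid_code N) (short_codes N) ->
  pairwise (fun d d' => ~~ same_code d d') (short_codes N) ->
  ((size (short_codes N))%:R%:E <= num_irreducible_components R (Leib C N.+1))%E.
Proof.
move=> N0 /all_nthP sval /(pairwiseP (0%N, [::])) sdiff.
rewrite -[size (short_codes N)]card_ord.
apply: (@Leib_components_ge N 'I_(size (short_codes N))
  (fun j => nth (0%N, [::]) (short_codes N) j)) => //.
  by move=> j; apply: sval.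
move=> j k; apply: contraTeq; rewrite -val_eqE neq_ltn => /orP[jk|kj].
  by apply: sdiff => //; rewrite inE.
by rewrite same_code_sym; apply: sdiff => //; rewrite inE.
Qed.

(** The words start with false and end with true, so none is the reversal of
another. *)
Lemma Leib_components_long N : (7 <= N)%N ->
  ((2 ^ ((N.-1)./2 - 2))%:R%:E <= num_irreducible_components R (Leib C N.+1))%E.
Proof.
move=> N7; set p := (N.-1)./2.
rewrite -(_ : #|{: (p - 2).-tuple bool}| = (2 ^ (p - 2))%N); last first.
  by rewrite card_tuple card_bool.
have szw (u : (p - 2).-tuple bool) : size (false :: rcons u true) = p.
  by rewrite /= size_rcons size_tuple /p; lia.
apply: (@Leib_components_ge N ((p - 2).-tuple bool)
  (fun u => (p.+1, false :: rcons u true))).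
- lia.
- by move=> u; rewrite /valid_code [(_, _).2]/= szw /= leqnn /p; lia.
- move=> u v; rewrite /same_code /= eqxx rev_cons rev_rcons /= orbF.
  by case/eqP => uv; apply: val_inj; apply: rcons_injl uv.
Qed.

End Counting.

(** * An upper bound for the Gamma function *)

Section GammaBound.
Variable (R : realType).

Lemma ln2_ge : 2^-1 <= ln 2 :> R.
Proof.
have := @le_ln1Dx R (- 2^-1); rewrite (_ : 1 + - 2^-1 = 2^-1); last by lra.
by rewrite lnV ?posrE // lerN2; apply; lra.
Qed.

(** That is, a <= 2^(a/2), by comparison with the tangent of ln at 4, where
equality holds. *)
Lemma ln_le_half_ln2 (a : R) : 4 <= a -> ln a <= a / 2 * ln 2.
Proof.
move=> a4; have -> : a = 2 * (2 * (1 + (a / 4 - 1))) by lra.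
rewrite !lnM ?posrE; try lra.
have := @le_ln1Dx R (a / 4 - 1); have := ln2_ge.
move: (ln (1 + _)) (ln 2) => y l l2 /(_ _)  yl.
have {}yl : y <= a / 4 - 1 by apply: yl; lra.
have : (a / 4 - 1) * (2 * l - 1) >= 0 by apply: mulr_ge0; lra.
nra.
Qed.

(** The maximum over t of t^a e^(-t/2) is (2a/e)^a, which is at most
a^a <= 2^(a^2/2). *)
Lemma Gamma_integrand_le (a t : R) : 4 <= a -> 0 < t ->
  t `^ a * expR (- t) <= expR (a ^+ 2 / 2 * ln 2) * expR (- (t / 2)).
Proof.
move=> a4 t0; rewrite /powR gt_eqF // -!expRD ler_expR.
have a0 : 0 < a by lra.
have ln2_le1 : ln 2 <= 1 :> R.
  by have := @le_ln1Dx R 1; rewrite (_ : 1 + 1 = 2) //; apply; lra.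
(* ln x = ln 2 + ln (x / 2) <= ln 2 + x / 2 - 1 <= x / 2, used at x = t / a *)
have lnta : ln t <= ln a + t / a / 2.
  have ta : 0 < t / a by apply: divr_gt0.
  have -> : ln t = ln a + (ln 2 + ln (1 + (t / a / 2 - 1))).
    by rewrite -!lnM ?posrE ?mulr_gt0 //; try lra; congr ln; field; lra.
  have : ln (1 + (t / a / 2 - 1)) <= t / a / 2 - 1 by apply: le_ln1Dx; lra.
  lra.
have := ler_wpM2l (ltW a0) lnta; have := ler_wpM2l (ltW a0) (ln_le_half_ln2 a4).
have -> : a * (ln a + t / a / 2) = a * ln a + t / 2 by field; lra.
have -> : a * (a / 2 * ln 2) = a ^+ 2 / 2 * ln 2 by ring.
lra.
Qed.

(** The bound on the integrand is 2 * 2^(a^2/2) times the density of the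
exponential distribution of rate 1/2. *)
Lemma Gamma_le (a : R) : 4 <= a ->
  (Gamma (1 + a) <= (2 * expR (a ^+ 2 / 2 * ln 2))%:E)%E.
Proof.
move=> a4; set M := expR _.
have pdf0 (t : R) : (0 <= (exponential_pdf 2^-1 t)%:E)%E.
  by rewrite lee_fin exponential_pdf_ge0 // invr_ge0.
have mpdf : measurable_fun (@setT R) (fun t : R => (exponential_pdf 2^-1 t)%:E).
  by apply/measurable_EFinP; exact: measurable_exponential_pdf.
rewrite /Gamma.
apply: (@le_trans _ _ (\int[lebesgue_measure]_(t in `]0%R, +oo[)
    ((2 * M)%:E * (exponential_pdf 2^-1 t)%:E))%E).
  apply: ge0_le_integral => //.
  - by move=> t _; rewrite lee_fin mulr_ge0 ?powR_ge0 ?expR_ge0.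
  - apply/measurable_EFinP; apply: measurable_funM.
      exact: measurable_funTS.
    apply: measurable_funTS; apply: measurableT_comp => //.
  - by apply: measurable_funeM; apply: measurable_funTS.
  - move=> t; rewrite /= in_itv /= andbT => t0.
    rewrite -EFinM lee_fin (exponential_pdfE _ (ltW t0)).
    rewrite [1 + a]addrC addrK; apply: le_trans (Gamma_integrand_le a4 t0) _.
    by rewrite -/M mulrACA divff // mul1r mulNr [_ * t]mulrC.
rewrite ge0_integralZl_EFin //; last 2 first.
- exact: measurable_funTS.
- by rewrite mulr_ge0 ?expR_ge0.
rewrite -[leRHS]mule1; apply: lee_pmul => //.
- by rewrite lee_fin mulr_ge0 ?expR_ge0.
- exact: integral_ge0.
rewrite -(@integral_exponential_pdf R 2^-1) ?invr_gt0 //.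
exact: ge0_subset_integral.
Qed.

(** With a = sqrt n - 1 the exponent a^2/2 + 1 is n/2 - sqrt n + 3/2, to be
compared with an integer that is at least (n - 7)/2. *)
Lemma Gamma_sqrt_le (n : nat) : (81 <= n)%N ->
  (Gamma (Num.sqrt (n%:R : R)) <= (2 ^ ((n.-2)./2 - 2))%:R%:E)%E.
Proof.
move=> n81; set s := Num.sqrt _.
have s2 : s ^+ 2 = n%:R by rewrite sqr_sqrtr.
have s0 : 0 <= s by apply: sqrtr_ge0.
have s9 : 9 <= s.
  rewrite -(@ler_sqr _ 9) ?nnegrE // s2 -natrX ler_nat //.
have -> : s = 1 + (s - 1) by ring.
apply: le_trans (Gamma_le _) _; first by lra.
set e := ((n.-2)./2 - 2)%N.
have eN : (n <= e.*2 + 7)%N by rewrite /e; lia.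
have {}eN : n%:R <= e%:R * 2 + 7 :> R.
  by move: eN; rewrite -(ler_nat R) natrD -mul2n natrM mulrC.
have ln20 : 0 <= ln 2 :> R by have := ln2_ge; lra.
rewrite lee_fin natrX -[X in X * expR _]lnK ?posrE // -expRD.
rewrite -[leRHS]lnK ?posrE ?exprn_gt0 // ler_expR lnXn // -[_ *+ e]mulr_natl.
rewrite -[X in X + _]mul1r -mulrDl ler_wpM2r //.
nra.
Qed.

End GammaBound.

Theorem corollary1 (R : realType) :
  (forall n : nat, (2 <= n)%N -> ~ irreducible (Leib R[i] n)) /\
  (5%:E <= num_irreducible_components R (Leib R[i] 6))%E /\
  (8%:E <= num_irreducible_components R (Leib R[i] 7))%E /\
  (33%:E <= num_irreducible_components R (Leib R[i] 8))%E /\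
  (41%:E <= num_irreducible_components R (Leib R[i] 9))%E /\
  (forall n : nat, (81 <= n)%N ->
    (Gamma (Num.sqrt (n%:R : R))
       <= num_irreducible_components R (Leib R[i] n))%E).
Proof.
have short N k : (0 < N)%N -> all (valid_code N) (short_codes N) ->
    pairwise (fun d d' => ~~ same_code d d') (short_codes N) ->
    (k <= size (short_codes N))%N ->
    (k%:R%:E <= num_irreducible_components R (Leib R[i] N.+1))%E.
  move=> N0 Nval Ndiff kN; apply: le_trans (Leib_components_short R N0 Nval Ndiff).
  by rewrite lee_fin ler_nat.
split; first by case=> [|[|n]] // _; exact: Leib_reducible.
split; first exact: (short 5%N 5%N).
split; first exact: (short 6%N 8%N).
split; first exact: (short 7%N 33%N).
split; first exact: (short 8%N 41%N).
case=> [//|n] n81; apply: le_trans (Gamma_sqrt_le R n81) _.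
by apply: Leib_components_long; lia.
Qed.
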